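(* Let $\mathbb{A}=(A_1,\dots,A_n)\in\mathbb{P}_m^n$ and $\omega=(w_1,\dots,w_n)\in\Delta_n$, and let $\lambda_{M} := \max \{ \lambda_{1}(A_{j}): 1 \leq j \leq n \}$. Let $0 < t \leq z < 1$. Then for all $p$ such that $p \leq z$ $$\mathcal{R}_{t,z}(\omega; \mathbb{A}) \leq \lambda_{M}^{t}\, \mathcal{Q}_{\frac{1}{p}}(\omega; \mathbb{A}^{1-t}).$$
   Context: $\mathbb{P}_m$ is the set of $m\times m$ complex Hermitian positive definite matrices; $\le$ is the Loewner order ($A\ge B$ iff $A-B$ is positive semidefinite); $\lambda_1(A)$ is the largest eigenvalue of $A$. $\Delta_n$ is the set of positive probability vectors $\omega=(w_1,\dots,w_n)$, i.e. $w_j>0$ and $\sum_j w_j=1$. For $0<t\le z<1$, the Rényi power mean $\mathcal{R}_{t,z}(\omega;\mathbb{A})$ is the unique $X\in\mathbb{P}_m$ satisfying $X=\sum_{j=1}^n w_j\left(A_j^{\frac{1-t}{2z}}X^{\frac{t}{z}}A_j^{\frac{1-t}{2z}}\right)^z$ (existence and uniqueness are known). For real $r\neq 0$, the quasi-arithmetic mean of order $r$ is $\mathcal{Q}_r(\omega;\mathbb{A})=\left(\sum_{j=1}^n w_jA_j^r\right)^{1/r}$, and $\mathbb{A}^{1-t}=(A_1^{1-t},\dots,A_n^{1-t})$; thus $\mathcal{Q}_{1/p}(\omega;\mathbb{A}^{1-t})=\left(\sum_{j=1}^n w_jA_j^{\frac{1-t}{p}}\right)^{p}$.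
   Formalization: The range ''p ≤ z'' is restricted to 0 < p ≤ z: the quasi-arithmetic mean of order 1/p is undefined at p = 0, and the inequality fails for every p < 0 (e.g. m = 1, A = (0.01, 1), equal weights, t = z = 1/2, p = -1). *)

(* Defs.v *)
From HB Require Import structures.
From mathcomp Require Import all_boot all_order all_algebra.
From mathcomp Require Import complex.
From mathcomp Require Import sesquilinear spectral.
From mathcomp Require Import all_classical all_reals all_analysis.

Set Implicit Arguments.
Unset Strict Implicit.
Unset Printing Implicit Defensive.

Import Order.TTheory GRing.Theory Num.Theory.

Local Open Scope ring_scope.
Local Open Scope complex_scope.
Local Open Scope sesquilinear_scope.
Local Open Scope classical_set_scope.

Section Matrices.
Context {R : realType} {m : nat}.
Implicit Types (A B X : 'M[R[i]]_m) (x : 'cV[R[i]]_m) (r : R).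

Definition qform A x : R[i] := (x ^t* *m A *m x) 0 0.

(* The order on R[i] is the partial one: [0 <= c] and [0 < c] entail that c is
   real. *)
Definition posdefmx A : Prop :=
  A \is hermsymmx /\ forall x, x != 0 -> 0 < qform A x.

Definition possemidefmx A : Prop :=
  A \is hermsymmx /\ forall x, 0 <= qform A x.

Definition loewner_le A B : Prop := possemidefmx (B - A).

Definition lambda1 A : R := sup [set a : R | eigenvalue A a%:C].

(* A = P^-1 diag(d) P with P unitary and d the spectrum of A (for A Hermitian);
   for A positive definite all d_i are positive reals, so the values of [powR]
   outside ]0, +oo[ are irrelevant. *)
Definition mxpow A r : 'M[R[i]]_m :=
  invmx (spectralmx A)
  *m diag_mx (map_mx (fun a => (complex.Re a `^ r)%:C) (spectral_diag A))
  *m spectralmx A.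

End Matrices.

Definition prob_vector {R : realType} {n : nat} (w : 'I_n -> R) : Prop :=
  (forall j, 0 < w j) /\ \sum_(j < n) w j = 1.

Section Means.
Context {R : realType} {m n : nat}.
Implicit Types (w : 'I_n -> R) (A : 'I_n -> 'M[R[i]]_m).

Definition quasi_mean (r : R) w A : 'M[R[i]]_m :=
  mxpow (\sum_(j < n) (w j)%:C *: mxpow (A j) r) (1 / r).

Definition renyi_map (t z : R) w A (X : 'M[R[i]]_m) : 'M[R[i]]_m :=
  \sum_(j < n) (w j)%:C *:
    mxpow (mxpow (A j) ((1 - t) / (2 * z))
           *m mxpow X (t / z)
           *m mxpow (A j) ((1 - t) / (2 * z))) z.

(* For 0 < t <= z < 1 and positive definite A_j there is exactly one such X. *)
Definition is_renyi_mean (t z : R) w A (X : 'M[R[i]]_m) : Prop :=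
  posdefmx X /\ X = renyi_map t z w A X.

(* The default 0 is harmless: the eigenvalues of positive definite matrices
   are positive. *)
Definition lambdaM A : R := \big[Num.max/0]_(j < n) lambda1 (A j).

End Means.

(* Main.v *)
Require Import Defs.
From mathcomp Require Import all_boot all_order all_algebra.
From mathcomp Require Import complex.
From mathcomp Require Import sesquilinear spectral.
From mathcomp Require Import all_classical all_reals all_analysis.
From mathcomp Require Import ring lra.

(** Let X be the Renyi power mean and M its largest eigenvalue.  Since
    X^(t/z) <= M^(t/z) I, each term (A^s X^(t/z) A^s)^z of the fixed-point
    equation, with s = (1-t)/(2z), is at most (M^(t/z) A^(2s))^z =
    M^t A^(1-t), because x^z is operator monotone for 0 <= z <= 1
    ([loewner_heinz], [renyi_term_le]).  Summing,
      X <= M^t \sum_j w_j A_j^(1-t).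
    Evaluating this at a unit eigenvector of X for M, and bounding A_j^(1-t) by
    lambdaM^(1-t) I, gives M <= M^t lambdaM^(1-t), that is M <= lambdaM
    ([renyi_mean_max_le]).  Finally \sum_j w_j B_j <= (\sum_j w_j B_j^(1/p))^p
    because x^p is operator concave for 0 <= p <= 1 ([arith_le_quasi_mean]).

    Operator monotonicity and operator concavity of x^r are both instances of
    one statement about positive definite C_j and S ([power_jensen]): if
    \sum_j w_j C_j <= S, then \sum_j w_j C_j^r <= S^r for all r in [0, 1].
    The exponents r for which the conclusion holds contain 0 and 1 and form a
    closed set by continuity, so it is enough that they are stable under
    midpoints, which is Pedersen's argument.  With q = (r+s)/2, each block
    matrix [[C_j^r, C_j^q], [C_j^q, C_j^s]] is positive semidefinite, its
    quadratic form at (u, v) being the squared norm of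
    C_j^(r/2) u + C_j^(s/2) v ([block_midpow_ge0]).  Summing, and using the
    inequalities for r and s, the block matrix [[S^r, Y], [Y, S^s]] with
    Y = \sum_j w_j C_j^q is positive semidefinite, and this forces Y <= S^q
    ([block_le_midpow]). *)

Import Order.TTheory GRing.Theory Num.Theory.

Local Open Scope ring_scope.
Local Open Scope complex_scope.
Local Open Scope sesquilinear_scope.

Set Implicit Arguments.
Unset Strict Implicit.
Unset Printing Implicit Defensive.

(** * Unitary diagonalization *)

Section Udiag.
Context {R : realType} {m : nat}.
Implicit Types (A B C U : 'M[R[i]]_m) (x y : 'cV[R[i]]_m) (d e : 'I_m -> R).

Lemma conjC_real (k : R) : Num.conj k%:C = k%:C.
Proof. exact: conjc_real. Qed.

Definition ctmx (a b : nat) (A : 'M[R[i]]_(a, b)) : 'M[R[i]]_(b, a) := A^t*.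

Lemma ctmxE (a b : nat) (A : 'M[R[i]]_(a, b)) j k : ctmx A j k = Num.conj (A k j).
Proof. by rewrite !mxE. Qed.

Lemma ctmxM (a b c : nat) (A : 'M[R[i]]_(a, b)) (B : 'M[R[i]]_(b, c)) :
  ctmx (A *m B) = ctmx B *m ctmx A.
Proof. by rewrite /ctmx trmx_mul map_mxM. Qed.

Lemma ctmxK (a b : nat) (A : 'M[R[i]]_(a, b)) : ctmx (ctmx A) = A.
Proof. exact: trmxCK. Qed.

Lemma ctmxZ (a b : nat) (k : R) (A : 'M[R[i]]_(a, b)) :
  ctmx (k%:C *: A) = k%:C *: ctmx A.
Proof.
apply/matrixP => i j; rewrite ctmxE [RHS]mxE ctmxE mxE rmorphM /=.
by apply: (f_equal (fun c => c * _)); exact: conjC_real.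
Qed.

Lemma ctmxD (a b : nat) (A B : 'M[R[i]]_(a, b)) : ctmx (A + B) = ctmx A + ctmx B.
Proof. by apply/matrixP => i j; rewrite ctmxE [RHS]mxE !ctmxE mxE rmorphD. Qed.

Lemma ctmxN (a b : nat) (A : 'M[R[i]]_(a, b)) : ctmx (- A) = - ctmx A.
Proof. by apply/matrixP => i j; rewrite ctmxE [RHS]mxE !ctmxE mxE rmorphN. Qed.

Lemma ctmx0 (a b : nat) : ctmx (0 : 'M[R[i]]_(a, b)) = 0.
Proof. by apply/matrixP => i j; rewrite ctmxE !mxE rmorph0. Qed.

Lemma hermsymmxE A : (A \is hermsymmx) = (ctmx A == A).
Proof. by rewrite qualifE expr0 scale1r eq_sym. Qed.

Lemma unitary_mulmxV U : U \is unitarymx -> U *m ctmx U = 1%:M.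
Proof. by move=> /unitarymxP. Qed.

Lemma unitary_mulVmx U : U \is unitarymx -> ctmx U *m U = 1%:M.
Proof.
by move=> hU; rewrite /ctmx -(invmx_unitary hU) mulVmx// unitarymx_unit.
Qed.

Definition rdiag d : 'M[R[i]]_m := diag_mx (\row_i (d i)%:C).

Lemma rdiag_ct d : ctmx (rdiag d) = rdiag d.
Proof.
rewrite /ctmx /rdiag tr_diag_mx map_diag_mx; apply: f_equal.
by apply/rowP => i; rewrite !mxE; exact: conjC_real.
Qed.

Lemma rdiagM d e : rdiag d *m rdiag e = rdiag (fun i => d i * e i).
Proof.
rewrite /rdiag mulmx_diag; apply: f_equal.
by apply/rowP => i; rewrite !mxE rmorphM.
Qed.

Lemma rdiagZ d (c : R) : c%:C *: rdiag d = rdiag (fun i => c * d i).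
Proof.
rewrite /rdiag -linearZ /=; apply: f_equal.
by apply/rowP => i; rewrite !mxE rmorphM.
Qed.

(** For U unitary, this is the Hermitian matrix with eigenvalue [d i] at the i-th
    column of U^*.  All powers of one positive definite matrix
    share the same U, which reduces identities between them to real numbers. *)
Definition udiag U d : 'M[R[i]]_m := ctmx U *m rdiag d *m U.

Lemma udiag_ct U d : ctmx (udiag U d) = udiag U d.
Proof. by rewrite /udiag !ctmxM ctmxK rdiag_ct mulmxA. Qed.

Lemma eq_udiag U d e : d =1 e -> udiag U d = udiag U e.
Proof. by move=> /funext ->. Qed.

Lemma udiagZ U d (c : R) : c%:C *: udiag U d = udiag U (fun i => c * d i).
Proof. by rewrite /udiag scalemxAl scalemxAr rdiagZ. Qed.

Lemma udiagM U d e : U \is unitarymx ->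
  udiag U d *m udiag U e = udiag U (fun i => d i * e i).
Proof.
move=> hU; rewrite /udiag -!mulmxA (mulmxA U) (unitary_mulmxV hU) mul1mx.
by rewrite (mulmxA (rdiag d)) rdiagM.
Qed.

Lemma udiag_cst U (c : R) : U \is unitarymx ->
  udiag U (fun=> c) = (c%:C)%:M.
Proof.
move=> hU; rewrite /udiag.
have -> : rdiag (fun=> c) = (c%:C)%:M.
  rewrite /rdiag -diag_const_mx; apply: f_equal.
  by apply/rowP => i; rewrite !mxE.
by rewrite mul_mx_scalar -scalemxAl (unitary_mulVmx hU) scalemx1.
Qed.

Lemma herm_udiag A : A \is hermsymmx ->
  exists U d, U \is unitarymx /\ A = udiag U d.
Proof.
move=> hA; exists (spectralmx A), (fun i => complex.Re (spectral_diag A 0 i)).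
split; first exact: spectral_unitarymx.
have /orthomx_spectralP {1}-> := hermitian_normalmx hA.
rewrite (invmx_unitary (spectral_unitarymx A)) -/(ctmx _) /udiag /rdiag.
suff -> : \row_i (complex.Re (spectral_diag A 0 i))%:C = spectral_diag A.
  exact: erefl.
apply/rowP => i; rewrite mxE RRe_real//.
by have /mxOverP := hermitian_spectral_diag_real hA; apply.
Qed.

(** Intertwining relations pass to the conjugated matrices; applied to two
    diagonalizations of one matrix. *)
Lemma unitary_transport (P U D E : 'M[R[i]]_m) :
    P \is unitarymx -> U \is unitarymx ->
  D *m (P *m ctmx U) = P *m ctmx U *m E -> ctmx P *m D *m P = ctmx U *m E *m U.
Proof.
move=> hP hU h; rewrite -[LHS]mulmx1 -(unitary_mulVmx hU).
have -> : ctmx P *m D *m P *m (ctmx U *m U) = ctmx P *m (D *m (P *m ctmx U)) *m U.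
  by rewrite !mulmxA.
by rewrite h !mulmxA (unitary_mulVmx hP) mul1mx.
Qed.

(** The power does not depend on the diagonalization: if P and U both diagonalize
    A, with eigenvalues a and d, then W = P U^* satisfies a_i W_ij = W_ij d_j, so
    wherever W_ij is nonzero a_i = d_j, and the relation survives applying a
    function to both spectra. *)
Lemma mxpow_udiag U d (r : R) : U \is unitarymx ->
  mxpow (udiag U d) r = udiag U (fun i => d i `^ r).
Proof.
move=> hU; set A := udiag U d.
have hA : A \is hermsymmx by rewrite hermsymmxE /A udiag_ct.
have hP := spectral_unitarymx A.
have /orthomx_spectralP := hermitian_normalmx hA.
rewrite /mxpow.
move: (spectralmx A) hP (spectral_diag A) => P hP a.
rewrite (invmx_unitary hP) -/(ctmx P) => eqA.
have eW : diag_mx a *m (P *m ctmx U) = P *m ctmx U *m rdiag d.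
  have : P *m A *m ctmx U = diag_mx a *m (P *m ctmx U).
    by rewrite eqA !mulmxA (unitary_mulmxV hP) mul1mx -mulmxA.
  by rewrite /A /udiag !mulmxA -(mulmxA _ U) (unitary_mulmxV hU) mulmx1 => <-.
have rW (V : 'M[R[i]]_m) : diag_mx a *m V = V *m rdiag d ->
    diag_mx (map_mx (fun c => (complex.Re c `^ r)%:C) a) *m V =
    V *m rdiag (fun i => d i `^ r).
  move=> eV; apply/matrixP => i j; move/matrixP: eV => /(_ i j).
  rewrite /rdiag !mul_diag_mx !mul_mx_diag !mxE.
  move: (V i j) => c; have [->|c0] := eqVneq c 0; first by rewrite !mulr0 !mul0r.
  by rewrite ![c * _]mulrC => /(mulIf c0) ->.
exact: unitary_transport hP hU (rW _ eW).
Qed.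

(** The squared modulus as a real number: the norm of R[i] takes its values in
    R[i]. *)
Definition normsq (c : R[i]) : R := complex.Re c ^+ 2 + complex.Im c ^+ 2.

Lemma normsq_ge0 c : 0 <= normsq c.
Proof. by rewrite addr_ge0// sqr_ge0. Qed.

Lemma mulC_normsq (c : R[i]) : Num.conj c * c = (normsq c)%:C.
Proof. by rewrite add_Re2_Im2 normCK mulrC. Qed.

Lemma qform_udiag U d x :
  qform (udiag U d) x = (\sum_i d i * normsq ((U *m x) i 0))%:C.
Proof.
rewrite /qform /udiag.
have -> : ctmx x *m (ctmx U *m rdiag d *m U) *m x =
   ctmx (U *m x) *m (rdiag d *m (U *m x)).
  by rewrite ctmxM !mulmxA.
move: (U *m x) => y; rewrite mxE rmorph_sum; apply: eq_bigr => i _.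
transitivity ((d i)%:C * (normsq (y i 0))%:C); last by rewrite -rmorphM.
by rewrite /rdiag mul_diag_mx !mxE mulrCA; congr (_ * _); exact: mulC_normsq.
Qed.

Definition eigvec U (i : 'I_m) : 'cV[R[i]]_m := ctmx U *m delta_mx i 0.

Lemma eigvec_coord U i j : U \is unitarymx ->
  (U *m eigvec U i) j 0 = (j == i)%:R :> R[i].
Proof.
by move=> hU; rewrite /eigvec mulmxA (unitary_mulmxV hU) mul1mx mxE andbT.
Qed.

Lemma qform_eigvec U d i : U \is unitarymx ->
  qform (udiag U d) (eigvec U i) = (d i)%:C.
Proof.
move=> hU; rewrite qform_udiag (bigD1 i)//= big1 ?addr0.
  by rewrite eigvec_coord// eqxx /normsq /= expr1n expr0n/= addr0 mulr1.
move=> j ji; rewrite eigvec_coord// (negPf ji) /normsq /= expr0n/= addr0 mulr0//.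
Qed.

Lemma udiag_eigvec U d i : U \is unitarymx ->
  udiag U d *m eigvec U i = (d i)%:C *: eigvec U i.
Proof.
move=> hU; rewrite /udiag /eigvec -!mulmxA (mulmxA U) (unitary_mulmxV hU) mul1mx scalemxAr.
congr (_ *m _); apply/colP => j; rewrite mul_diag_mx !mxE andbT.
by case: eqVneq => [->|]; rewrite ?mulr0.
Qed.

Lemma eigvec_neq0 U i : U \is unitarymx ->
  eigvec U i != 0.
Proof.
move=> hU; apply/eqP => /(congr1 (fun v => (U *m v) i 0)).
by rewrite eigvec_coord// eqxx mulmx0 mxE => /eqP; rewrite oner_eq0.
Qed.

Lemma posdef_udiag A : posdefmx A ->
  exists U d, [/\ U \is unitarymx, forall i, 0 < d i & A = udiag U d].
Proof.
move=> [/herm_udiag[U [d [hU ->]]] pA]; exists U, d; split=> // i.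
by rewrite -ltcR -(qform_eigvec d i hU) pA// eigvec_neq0.
Qed.

Lemma udiag_posdef U d : U \is unitarymx -> (forall i, 0 < d i) ->
  posdefmx (udiag U d).
Proof.
move=> hU d0; split=> [|x x0]; first by rewrite hermsymmxE udiag_ct.
rewrite qform_udiag ltcR; rewrite lt_def sumr_ge0 ?andbT; last first.
  by move=> i _; rewrite mulr_ge0 ?normsq_ge0 ?ltW.
apply: contra x0; rewrite psumr_eq0; last first.
  by move=> i _; rewrite mulr_ge0 ?normsq_ge0 ?ltW.
move=> /allP h; apply/eqP; rewrite -[x]mul1mx -(unitary_mulVmx hU) -mulmxA.
suff -> : U *m x = 0 by rewrite mulmx0.
apply/colP => i; rewrite [RHS]mxE; have := h i (mem_index_enum _).
rewrite mulf_eq0 gt_eqF//= => /eqP n0; apply/eqP.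
by rewrite -normr_eq0 -sqrf_eq0 -add_Re2_Im2 -/(normsq _) n0.
Qed.

(** Makes the set of eigenvalues bounded, so that its supremum is meaningful. *)
Lemma eigenvalue_udiag U d (a : R[i]) : U \is unitarymx ->
  eigenvalue (udiag U d) a -> exists i, a = (d i)%:C.
Proof.
move=> hU /eigenvalueP[v va v0].
have vU0 : v *m ctmx U != 0.
  by apply: contra v0 => /eqP h; rewrite -[v]mulmx1 -(unitary_mulVmx hU) mulmxA h mul0mx.
have /rV0Pn[i hi] := vU0; exists i.
have /(congr1 (fun Y => (Y *m ctmx U) 0 i)) := va.
rewrite /udiag !mulmxA -(mulmxA _ U) (unitary_mulmxV hU) mulmx1 mul_mx_diag -scalemxAl.
rewrite [LHS]mxE [X in _ * X]mxE [RHS]mxE mulrC => /(mulIf hi) ->//.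
Qed.

Lemma le_lambda1 U d i : U \is unitarymx -> d i <= lambda1 (udiag U d).
Proof.
move=> hU; apply: ub_le_sup.
  exists (\sum_j `|d j|) => a /= /(eigenvalue_udiag hU)[j] /complexI ->.
  by rewrite (bigD1 j)//= (le_trans (ler_norm _))// lerDl sumr_ge0.
apply/eigenvalueP; exists (ctmx (eigvec U i)).
  rewrite -(udiag_ct U d) -ctmxM (udiag_eigvec d i hU); exact: ctmxZ.
apply: contra (eigvec_neq0 i hU) => /eqP h.
by rewrite -[X in X == _]ctmxK h ctmx0.
Qed.

End Udiag.

(** * Powers of positive definite matrices *)

Section Powers.
Context {R : realType} {m : nat}.
Implicit Types (A B C : 'M[R[i]]_m) (r s : R).

Lemma mxpow_posdef A r : posdefmx A -> posdefmx (mxpow A r).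
Proof.
move=> /posdef_udiag[U [d [hU d0 ->]]]; rewrite (mxpow_udiag _ _ hU).
by apply: (udiag_posdef hU) => i; rewrite powR_gt0.
Qed.

Lemma mxpowD A r s : posdefmx A -> mxpow A r *m mxpow A s = mxpow A (r + s).
Proof.
move=> /posdef_udiag[U [d [hU d0 ->]]]; rewrite !(mxpow_udiag _ _ hU).
rewrite (udiagM _ _ hU); apply: eq_udiag => i.
by rewrite powRD//; apply/implyP => _; rewrite gt_eqF.
Qed.

Lemma mxpow_mxpow A r s : posdefmx A -> mxpow (mxpow A r) s = mxpow A (r * s).
Proof.
move=> /posdef_udiag[U [d [hU d0 ->]]]; rewrite !(mxpow_udiag _ _ hU).
by apply: eq_udiag => i; rewrite powRrM.
Qed.

Lemma mxpow0 A : posdefmx A -> mxpow A 0 = 1%:M.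
Proof.
move=> /posdef_udiag[U [d [hU d0 ->]]]; rewrite !(mxpow_udiag _ _ hU).
rewrite -(udiag_cst 1 hU); apply: eq_udiag => i; exact: powRr0.
Qed.

Lemma mxpow1 A : posdefmx A -> mxpow A 1 = A.
Proof.
move=> /posdef_udiag[U [d [hU d0 ->]]]; rewrite !(mxpow_udiag _ _ hU).
by apply: eq_udiag => i; rewrite powRr1// ltW.
Qed.

Lemma mxpowZ A (c : R) r : 0 <= c -> posdefmx A ->
  mxpow (c%:C *: A) r = (c `^ r)%:C *: mxpow A r.
Proof.
move=> c0 /posdef_udiag[U [d [hU d0 ->]]]; rewrite udiagZ !(mxpow_udiag _ _ hU).
by rewrite udiagZ; apply: eq_udiag => i; rewrite powRM// ltW.
Qed.

(** Exhibits the dependence on the exponent as a finite sum of real exponentials,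
    for the continuity argument. *)
Lemma qform_mxpow A x : posdefmx A -> exists c d : 'I_m -> R,
  (forall i, 0 < d i) /\
  forall r, qform (mxpow A r) x = (\sum_i d i `^ r * c i)%:C.
Proof.
move=> /posdef_udiag[U [d [hU d0 ->]]].
exists (fun i => normsq ((U *m x) i 0)), d; split=> // r.
by rewrite (mxpow_udiag _ _ hU) qform_udiag.
Qed.

Lemma posdef_ct A : posdefmx A -> ctmx A = A.
Proof. by case; rewrite hermsymmxE => /eqP. Qed.

End Powers.

(** * Sesquilinear forms and the Loewner order *)

Section Forms.
Context {R : realType} {m : nat}.
Implicit Types (A B C : 'M[R[i]]_m) (r s : R) (x y u v : 'cV[R[i]]_m).

Definition bform A x y : R[i] := (ctmx x *m A *m y) 0 0.

Lemma bformxx A x : bform A x x = qform A x.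
Proof. by []. Qed.

Lemma bformMl A B x y : ctmx B = B -> bform A (B *m x) y = bform (B *m A) x y.
Proof. by move=> hB; rewrite /bform ctmxM hB !mulmxA. Qed.

Lemma bformMr A B x y : bform A x (B *m y) = bform (A *m B) x y.
Proof. by rewrite /bform !mulmxA. Qed.

Lemma qformM A B x : ctmx B = B -> qform A (B *m x) = qform (B *m A *m B) x.
Proof. by move=> hB; rewrite -!bformxx bformMl// bformMr. Qed.

Lemma bformDl A x y z : bform A (x + y) z = bform A x z + bform A y z.
Proof. by rewrite /bform ctmxD !mulmxDl mxE. Qed.

Lemma bformDr A x y z : bform A x (y + z) = bform A x y + bform A x z.
Proof. by rewrite /bform mulmxDr mxE. Qed.

Lemma bformNl A x y : bform A (- x) y = - bform A x y.
Proof. by rewrite /bform ctmxN !mulNmx mxE. Qed.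

Lemma bformNr A x y : bform A x (- y) = - bform A x y.
Proof. by rewrite /bform mulmxN mxE. Qed.

Lemma bform_sum (n : nat) (c : 'I_n -> R) (A : 'I_n -> 'M[R[i]]_m) x y :
  bform (\sum_j (c j)%:C *: A j) x y = \sum_j (c j)%:C * bform (A j) x y.
Proof.
rewrite /bform mulmx_sumr mulmx_suml summxE; apply: eq_bigr => j _.
by rewrite -scalemxAr -scalemxAl mxE.
Qed.

Lemma ctmx_congr A B : ctmx B = B -> ctmx A = A ->
  ctmx (B *m A *m B) = B *m A *m B.
Proof. by move=> hB hA; rewrite !ctmxM hA hB mulmxA. Qed.

Lemma qform_sum (n : nat) (c : 'I_n -> R) (A : 'I_n -> 'M[R[i]]_m) x :
  qform (\sum_j (c j)%:C *: A j) x = \sum_j (c j)%:C * qform (A j) x.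
Proof. exact: bform_sum. Qed.

Lemma qformZ (c : R[i]) A x : qform (c *: A) x = c * qform A x.
Proof. by rewrite /qform -scalemxAr -scalemxAl mxE. Qed.

Lemma qformB A B x : qform (A - B) x = qform A x - qform B x.
Proof. by rewrite /qform mulmxBr mulmxBl !mxE. Qed.

Lemma qform1_ge0 x : 0 <= qform (1%:M : 'M[R[i]]_m) x.
Proof.
rewrite /qform mulmx1 mxE sumr_ge0// => i _.
rewrite !mxE; have := mulC_normsq (x i 0) => /[dup] e.
by move=> ->; rewrite lecR normsq_ge0.
Qed.

Lemma loewner_leP A B : ctmx A = A -> ctmx B = B ->
  loewner_le A B <-> forall x, qform A x <= qform B x.
Proof.
move=> hA hB; split=> [[_ h] x|h].
  by have := h x; rewrite qformB subr_ge0.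
split=> [|x]; last by rewrite qformB subr_ge0.
by rewrite hermsymmxE ctmxD ctmxN hA hB.
Qed.

Lemma ctmx_sum (n : nat) (c : 'I_n -> R) (A : 'I_n -> 'M[R[i]]_m) :
  (forall j, ctmx (A j) = A j) ->
  ctmx (\sum_j (c j)%:C *: A j) = \sum_j (c j)%:C *: A j.
Proof.
move=> hA; rewrite (big_morph _ (@ctmxD _ _ _) (@ctmx0 _ _ _)).
by apply: eq_bigr => j _; rewrite ctmxZ hA.
Qed.

Lemma posdefZ (c : R) A : 0 < c -> posdefmx A -> posdefmx (c%:C *: A).
Proof.
move=> c0 pA; split; first by rewrite hermsymmxE ctmxZ (posdef_ct pA).
by move=> x x0; rewrite qformZ mulr_gt0 ?ltcR//; case: pA => _; apply.
Qed.

Lemma posdef_congr A B B' : posdefmx A -> ctmx B = B -> B' *m B = 1%:M ->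
  posdefmx (B *m A *m B).
Proof.
move=> pA hB B'B; split.
  by rewrite hermsymmxE (ctmx_congr hB (posdef_ct pA)).
move=> x x0; rewrite -(qformM _ _ hB); case: pA => _; apply.
apply: contra x0 => /eqP Bx0.
by rewrite -[x]mul1mx -B'B -mulmxA Bx0 mulmx0.
Qed.

Lemma posdef_qform_ge0 A x : posdefmx A -> 0 <= qform A x.
Proof.
case=> _ pA; have [->|x0] := eqVneq x 0; last by rewrite ltW// pA.
by rewrite /qform mulmx0 mxE.
Qed.

Lemma posdef_sum (n : nat) (w : 'I_n -> R) (C : 'I_n -> 'M[R[i]]_m) (j0 : 'I_n) :
  (forall j, 0 < w j) -> (forall j, posdefmx (C j)) ->
  posdefmx (\sum_j (w j)%:C *: C j).
Proof.
move=> w0 pC; split.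
  by rewrite hermsymmxE ctmx_sum// => j; exact: posdef_ct.
move=> x x0; have p j : 0 < (w j)%:C * qform (C j) x.
  by rewrite mulr_gt0 ?ltcR//; case: (pC j) => _; apply.
rewrite (qform_sum w C) (bigD1 j0)//= ltr_wpDr//.
by apply: sumr_ge0 => j _; exact: ltW.
Qed.

(** * The midpoint inequality *)

(** The two block-matrix facts depend only on the group law of the powers
    a |-> S^a, hence the formulation for a one-parameter group P. *)
Section PowerGroup.
Variable P : R -> 'M[R[i]]_m.
Hypothesis Ppos : forall a, posdefmx (P a).
Hypothesis PD : forall a b, P a *m P b = P (a + b).
Hypothesis P0 : P 0 = 1%:M.

Let hP a : ctmx (P a) = P a. Proof. exact/posdef_ct. Qed.

(** Conjugating the block matrix to compare X with P ((r + s) / 2) would replace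
    X by a non-Hermitian matrix, similar to the Hermitian Y.  The similarity
    preserves eigenvalues, so the block form is evaluated at the images of an
    eigenvector y of Y; there it equals 2 (1 - mu) times the value of
    P ((s - r) / 2) at y. *)
Lemma block_eigenvalue_le1 X Y y r s (mu : R) :
  (forall u v, 0 <= qform (P r) u + bform X u v + bform X v u + qform (P s) v) ->
  X = P ((r + s) / 4) *m Y *m P ((r + s) / 4) -> ctmx Y = Y ->
  y != 0 -> Y *m y = mu%:C *: y -> mu <= 1.
Proof.
move=> hblock eX hY y0 Yy.
set q := (r + s) / 4 in eX.
have TTi : P q *m P (- q) = 1%:M by rewrite PD subrr P0.
have TiT : P (- q) *m P q = 1%:M by rewrite PD addNr P0.
have yY : ctmx y *m Y = mu%:C *: ctmx y by rewrite -{1}hY -ctmxM Yy ctmxZ.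
have pN : 0 < qform (P ((s - r) / 2)) y.
  by have [_] := Ppos ((s - r) / 2); apply.
(* The exponents a and - q are chosen so that the four terms of the block form
   all become multiples of the value of P ((s - r) / 2) at y. *)
pose a := (s - 3 * r) / 4.
have := hblock (- (P a *m y)) (P (- q) *m y).
rewrite -bformxx !(bformNl, bformNr) opprK bformxx !qformM//.
rewrite !PD [a + r + a](_ : _ = (s - r) / 2); last by rewrite /a; lra.
rewrite [- q + s - q](_ : _ = (s - r) / 2); last by rewrite /q; lra.
have aq : a + q = (s - r) / 2 by rewrite /a /q; lra.
have -> : bform X (P a *m y) (P (- q) *m y) =
    mu%:C * qform (P ((s - r) / 2)) y.
  rewrite bformMl// bformMr {1}eX -!mulmxA TTi mulmx1 mulmxA PD aq.
  by rewrite /bform -!mulmxA Yy -!scalemxAr !mulmxA mxE.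
have -> : bform X (P (- q) *m y) (P a *m y) =
    mu%:C * qform (P ((s - r) / 2)) y.
  rewrite bformMl// bformMr {1}eX !mulmxA TiT mul1mx -mulmxA PD addrC aq.
  by rewrite /bform !mulmxA yY -!scalemxAl mxE.
move: (qform _ y) pN => N pN.
have -> : N - mu%:C * N - mu%:C * N + N = (1 - mu%:C) * N *+ 2.
  by rewrite mulr2n; ring.
by rewrite pmulrn_lge0// pmulr_lge0// subr_ge0 lecR.
Qed.

(** X = P q Y P q with all eigenvalues of Y at most 1, so X <= P q P q. *)
Lemma block_le_midpow X r s : ctmx X = X ->
  (forall u v, 0 <= qform (P r) u + bform X u v + bform X v u + qform (P s) v) ->
  forall x, qform X x <= qform (P ((r + s) / 2)) x.
Proof.
move=> hX hblock; set q := (r + s) / 4.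
have TTi : P q *m P (- q) = 1%:M by rewrite PD subrr P0.
have TiT : P (- q) *m P q = 1%:M by rewrite PD addNr P0.
have hY : ctmx (P (- q) *m X *m P (- q)) = P (- q) *m X *m P (- q).
  exact: ctmx_congr.
have eX : X = P q *m (P (- q) *m X *m P (- q)) *m P q.
  by rewrite !mulmxA TTi mul1mx -mulmxA TiT mulmx1.
move: (P (- q) *m X *m P (- q)) hY eX => Y hY eX.
have [|U [mu [hU eY]]] := @herm_udiag _ _ Y; first by rewrite hermsymmxE hY.
have mu1 i : mu i <= 1.
  apply: (block_eigenvalue_le1 hblock eX hY (eigvec_neq0 i hU)).
  by rewrite eY udiag_eigvec.
move=> x; rewrite {1}eX -(qformM _ _ (hP q)).
have -> : P ((r + s) / 2) = P q *m udiag U (fun=> 1) *m P q.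
  by rewrite (udiag_cst 1 hU) mulmx1 PD; congr P; rewrite /q; lra.
rewrite -(qformM _ _ (hP q)) eY !qform_udiag lecR; apply: ler_sum => j _.
by rewrite ler_wpM2r// normsq_ge0.
Qed.

(** The form is the squared norm of P (r / 2) u + P (s / 2) v. *)
Lemma block_midpow_ge0 r s u v :
  0 <= qform (P r) u + bform (P ((r + s) / 2)) u v
       + bform (P ((r + s) / 2)) v u + qform (P s) v.
Proof.
have := qform1_ge0 (P (r / 2) *m u + P (s / 2) *m v).
rewrite -bformxx bformDl !bformDr !(bformMl, bformMr)// !mulmx1 !PD.
by rewrite -!splitr -!mulrDl !bformxx [s + r]addrC !addrA.
Qed.

End PowerGroup.

End Forms.

(** * From midpoints to all exponents *)

Import numFieldNormedType.Exports.

Section Density.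
Context {R : realType}.

(** Bisection towards r keeps both ends of the interval in E. *)
Lemma midpoint_dense (E : R -> Prop) : E 0 -> E 1 ->
  (forall r s, E r -> E s -> E ((r + s) / 2)) ->
  forall r, 0 <= r <= 1 -> forall e, 0 < e -> exists2 a, E a & `|r - a| < e.
Proof.
move=> E0 E1 Emid r /andP[r0 r1] e e0.
have bisect (k : nat) : exists a b, [/\ E a, E b, a <= r, r <= b & b - a = 2^-1 ^+ k].
  elim: k => [|k [a [b [Ea Eb ar rb ab]]]].
    by exists 0, 1; rewrite subr0 expr0.
  have [rm|/ltW mr] := leP r ((a + b) / 2).
    exists a, ((a + b) / 2); split=> //; first exact: Emid.
    by rewrite exprS -ab; field.
  exists ((a + b) / 2), b; split=> //; first exact: Emid.
  by rewrite exprS -ab; field.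
have [k ke] : exists k, 2^-1 ^+ k < e.
  have half : `|2^-1 : R| < 1 by rewrite ger0_norm; lra.
  have /cvgrPdist_lt /(_ _ e0) [k _ /(_ k (leqnn k))] := cvg_expr half.
  by rewrite sub0r normrN ger0_norm ?exprn_ge0//; exists k.
have [a [b [Ea _ ar rb ab]]] := bisect k; exists a => //.
by rewrite ger0_norm ?subr_ge0// (le_lt_trans _ ke)// -ab lerD2r.
Qed.

Lemma continuous_ge0_dense (g : R -> R) r : {for r, continuous g} ->
  (forall e, 0 < e -> exists2 a, 0 <= g a & `|r - a| < e) -> 0 <= g r.
Proof.
move=> cg dense; rewrite leNgt; apply/negP => gr0.
have [e /= e0 he] := cvgr_lt _ cg _ gr0.
have [a ga ra] := dense e e0.
by have := he a ra; rewrite ltNge ga.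
Qed.

Lemma continuous_sumr (n : nat) (f : 'I_n -> R -> R) :
  (forall i, continuous (f i)) -> continuous (fun r => \sum_i f i r).
Proof. by move=> cf; apply: continuous_big => //; exact: add_continuous. Qed.

Lemma continuous_powR_sum (m : nat) (c d : 'I_m -> R) : (forall i, 0 < d i) ->
  continuous (fun r : R => \sum_i d i `^ r * c i).
Proof.
move=> d0; apply: continuous_sumr => i r; apply: cvgM; last exact: cvg_cst.
have -> : powR (d i) = fun x => expR (x * ln (d i)).
  by apply/funext => x; rewrite /powR gt_eqF.
apply: (@cvg_comp _ _ _ (fun x => x * ln (d i)) expR);
  last exact: continuous_expR.
by apply: cvgM; [exact: cvg_id|exact: cvg_cst].
Qed.

End Density.

(** * Operator monotonicity and concavity of powers *)

Section PowerJensen.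
Context {R : realType} {m n : nat}.
Variables (C : 'I_n -> 'M[R[i]]_m) (w : 'I_n -> R) (S : 'M[R[i]]_m).
Hypothesis pC : forall j, posdefmx (C j).
Hypothesis w0 : forall j, 0 <= w j.
Hypothesis pS : posdefmx S.

Let E r := forall x,
  \sum_j (w j)%:C * qform (mxpow (C j) r) x <= qform (mxpow S r) x.

Let E_mid r s : E r -> E s -> E ((r + s) / 2).
Proof.
move=> Er Es x.
rewrite -(qform_sum w (fun j => mxpow (C j) ((r + s) / 2))).
apply: (block_le_midpow (P := mxpow S)).
- by move=> a; exact: mxpow_posdef.
- by move=> a b; exact: mxpowD.
- exact: mxpow0.
- by apply: ctmx_sum => j; apply/posdef_ct/mxpow_posdef.
move=> u v.
rewrite !(bform_sum w (fun j => mxpow (C j) ((r + s) / 2))).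
apply: (@le_trans _ _ (\sum_j (w j)%:C *
   (qform (mxpow (C j) r) u + bform (mxpow (C j) ((r + s) / 2)) u v
    + bform (mxpow (C j) ((r + s) / 2)) v u + qform (mxpow (C j) s) v))).
  apply: sumr_ge0 => j _; apply: mulr_ge0; first by rewrite lecR.
  apply: (block_midpow_ge0 (P := mxpow (C j))).
  + by move=> a; exact: mxpow_posdef.
  + by move=> a b; exact: mxpowD.
under eq_bigr do rewrite !mulrDr.
rewrite !big_split /=.
apply: lerD; last exact: Es.
apply: lerD; last exact: lexx.
apply: lerD; last exact: lexx.
exact: Er.
Qed.

(** A single term with weight 1 gives operator monotonicity of x^r, and
    S = \sum_j w_j C_j gives its operator concavity; the midpoint argument proves
    both at once. *)
Lemma power_jensen r : 0 <= r <= 1 -> \sum_j w j <= 1 ->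
  (forall x, \sum_j (w j)%:C * qform (C j) x <= qform S x) ->
  forall x, \sum_j (w j)%:C * qform (mxpow (C j) r) x <= qform (mxpow S r) x.
Proof.
move=> r01 w1 hS.
have E0 : E 0.
  move=> x; rewrite (mxpow0 pS).
  under eq_bigr => j _ do rewrite (mxpow0 (pC j)).
  rewrite -mulr_suml -rmorph_sum ler_piMl ?qform1_ge0//.
  by rewrite lecR.
have E1 : E 1.
  move=> x; rewrite (mxpow1 pS).
  by under eq_bigr => j _ do rewrite (mxpow1 (pC j)).
move=> x.
have [cS [dS [dS0 qS]]] := qform_mxpow x pS.
pose f j a := complex.Re (qform (mxpow (C j) a) x).
have fE j a : qform (mxpow (C j) a) x = (f j a)%:C.
  by have [c [d [_ q]]] := qform_mxpow x (pC j); rewrite /f q.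
have cf j : continuous (f j).
  have [c [d [d0 q]]] := qform_mxpow x (pC j).
  have -> : f j = fun a => \sum_i d i `^ a * c i by apply/funext=> a; rewrite /f q.
  exact: continuous_powR_sum.
pose g a := \sum_i dS i `^ a * cS i - \sum_j w j * f j a.
have gE a : (\sum_j (w j)%:C * qform (mxpow (C j) a) x <= qform (mxpow S a) x)
    = (0 <= g a).
  have -> : \sum_j (w j)%:C * qform (mxpow (C j) a) x
      = (\sum_j w j * f j a)%:C.
    by rewrite rmorph_sum; apply: eq_bigr => j _; rewrite fE rmorphM.
  by rewrite qS /g subr_ge0 lecR.
rewrite gE; apply: continuous_ge0_dense.
  apply: cvgB; first exact: continuous_powR_sum.
  by apply: continuous_sumr => j a; apply: cvgM; [exact: cvg_cst|exact: cf].
move=> e e0; have [a Ea ra] := midpoint_dense E0 E1 E_mid r01 e0.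
by exists a; [rewrite -gE; exact: Ea|exact: ra].
Qed.

End PowerJensen.

Section Posdef.
Context {R : realType} {m : nat}.
Implicit Types (A B C X : 'M[R[i]]_m).

Lemma loewner_heinz A B (r : R) : posdefmx A -> posdefmx B -> 0 <= r <= 1 ->
  (forall x, qform A x <= qform B x) ->
  forall x, qform (mxpow A r) x <= qform (mxpow B r) x.
Proof.
move=> pA pB r01 AB x.
have := @power_jensen R m 1 (fun=> A) (fun=> 1) B (fun=> pA) (fun=> ler01) pB
  r r01.
rewrite !big_ord1 => /(_ (lexx _)) h; have := h _ x.
rewrite !big_ord1 mul1r; apply=> y; rewrite big_ord1 mul1r; exact: AB.
Qed.

(** * Bounds by the largest eigenvalue *)

Lemma udiag_mxpow_le U (d : 'I_m -> R) (c r : R) x : U \is unitarymx ->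
  (forall i, 0 < d i <= c) -> 0 <= r ->
  qform (mxpow (udiag U d) r) x <= (c `^ r)%:C * qform 1%:M x.
Proof.
move=> hU dc r0; rewrite (mxpow_udiag _ _ hU) -(udiag_cst 1 hU) -qformZ udiagZ.
rewrite !qform_udiag lecR; apply: ler_sum => i _; rewrite ler_wpM2r ?normsq_ge0//.
have /andP[d0 dle] := dc i; rewrite mulr1 ge0_ler_powR// nnegrE ltW//.
exact: lt_le_trans dle.
Qed.

Lemma mxpow_le_lambda1 A (c r : R) x : posdefmx A -> lambda1 A <= c -> 0 <= r ->
  qform (mxpow A r) x <= (c `^ r)%:C * qform 1%:M x.
Proof.
move=> /posdef_udiag[U [d [hU d0 ->]]] lc r0.
by apply: udiag_mxpow_le => // i; rewrite d0 (le_trans (le_lambda1 _ _ hU)).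
Qed.

Lemma posdef_max_eigen X : (0 < m)%N -> posdefmx X ->
  exists M : R, [/\ 0 < M,
   forall (r : R) x, 0 <= r -> qform (mxpow X r) x <= (M `^ r)%:C * qform 1%:M x &
   exists2 v, qform (1%:M : 'M[R[i]]_m) v = 1 & qform X v = M%:C].
Proof.
move=> m0 /posdef_udiag[U [d [hU d0 ->]]].
pose k := [arg max_(i > Ordinal m0) d i]%O.
exists (d k); split=> // [r x r0|].
  apply: udiag_mxpow_le => // i; rewrite d0 /k.
  by case: arg_maxP => // j _; apply.
exists (eigvec U k); last exact: qform_eigvec.
by rewrite -(udiag_cst 1 hU) qform_eigvec.
Qed.

End Posdef.

Lemma lambdaM_ge (R : realType) (m n : nat) (A : 'I_n -> 'M[R[i]]_m) j :
  lambda1 (A j) <= lambdaM A.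
Proof. exact: le_bigmax. Qed.

Lemma le_of_le_powRM (R : realType) (M L t : R) : 0 < M -> 0 <= L -> 0 < t < 1 ->
  M <= M `^ t * L `^ (1 - t) -> M <= L.
Proof.
move=> M0 L0 /andP[t0 t1] h; rewrite leNgt; apply/negP => LM.
suff : M `^ t * L `^ (1 - t) < M by rewrite ltNge h.
have {2}<- : M `^ t * M `^ (1 - t) = M.
  rewrite -powRD; last by apply/implyP => _; rewrite gt_eqF.
  by rewrite [t + _]addrC subrK powRr1// ltW.
by rewrite ltr_pM2l ?powR_gt0// gt0_ltr_powR ?subr_gt0 ?nnegrE// ltW.
Qed.

(** * Comparison of the means *)

Section Renyi.
Context {R : realType} {m n : nat}.
Variables (A : 'I_n -> 'M[R[i]]_m) (w : 'I_n -> R).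
Hypothesis hA : forall j, posdefmx (A j).
Hypothesis hw : prob_vector w.

(** Operator monotonicity of x^z allows replacing X^(t/z) by the scalar M^(t/z);
    the scalar commutes with B, so the powers can then be combined. *)
Lemma renyi_term_le (B X : 'M[R[i]]_m) (t z M : R) : posdefmx B -> posdefmx X ->
  0 < t -> t <= z -> z < 1 -> 0 < M ->
  (forall x, qform (mxpow X (t / z)) x <= (M `^ (t / z))%:C * qform 1%:M x) ->
  forall x,
  qform (mxpow (mxpow B ((1 - t) / (2 * z)) *m mxpow X (t / z)
           *m mxpow B ((1 - t) / (2 * z))) z) x
   <= (M `^ t)%:C * qform (mxpow B (1 - t)) x.
Proof.
move=> pB pX t0 tz z1 M0 hM x.
have z0 : 0 < z by exact: lt_le_trans tz.
have zn0 : z != 0 by rewrite gt_eqF.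
set s := (1 - t) / (2 * z).
have hs : ctmx (mxpow B s) = mxpow B s by exact/posdef_ct/mxpow_posdef.
have inv : mxpow B (- s) *m mxpow B s = 1%:M.
  by rewrite (mxpowD _ _ pB) addNr (mxpow0 pB).
have e1 : (s + s) * z = 1 - t by rewrite /s; field.
have e2 : t / z * z = t by field.
have pBs := mxpow_posdef (s + s) pB.
have -> : (M `^ t)%:C * qform (mxpow B (1 - t)) x =
    qform (mxpow ((M `^ (t / z))%:C *: mxpow B (s + s)) z) x.
  rewrite (mxpowZ z (powR_ge0 _ _) pBs) qformZ -powRrM e2.
  by rewrite (mxpow_mxpow (s + s) z pB) e1.
apply: loewner_heinz.
- exact: posdef_congr (mxpow_posdef _ pX) hs inv.
- by apply: posdefZ => //; rewrite powR_gt0.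
- by rewrite ltW//= ltW.
move=> y; rewrite -(qformM _ _ hs) (le_trans (hM _))//.
by rewrite (qformM _ _ hs) mulmx1 (mxpowD _ _ pB) qformZ.
Qed.

Lemma renyi_mean_le (X : 'M[R[i]]_m) (t z M : R) : is_renyi_mean t z w A X ->
  0 < t -> t <= z -> z < 1 -> 0 < M ->
  (forall x, qform (mxpow X (t / z)) x <= (M `^ (t / z))%:C * qform 1%:M x) ->
  forall x, qform X x <= (M `^ t)%:C *
    \sum_j (w j)%:C * qform (mxpow (A j) (1 - t)) x.
Proof.
move=> [pX eX] t0 tz z1 M0 hM x; rewrite {1}eX.
rewrite /renyi_map (qform_sum w) mulr_sumr; apply: ler_sum => j _.
rewrite mulrCA; apply: ler_wpM2l; first by rewrite lecR ltW//; case: hw.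
exact: renyi_term_le.
Qed.

(** A vector summing to 1 has an entry; gives the positivity of weighted sums. *)
Lemma prob_vector_index : 'I_n.
Proof.
case: hw => _; case: (n) w => [|k] v; last by move=> _; exact: ord0.
by rewrite big_ord0 => /eqP; rewrite eq_sym oner_eq0.
Qed.

Lemma quasi_mean_posdef (B : 'I_n -> 'M[R[i]]_m) (r : R) :
  (forall j, posdefmx (B j)) -> posdefmx (quasi_mean r w B).
Proof.
move=> pB; have [w0 _] := hw; apply: mxpow_posdef.
apply: (posdef_sum prob_vector_index w0) => j; exact: mxpow_posdef.
Qed.

(** Operator concavity of x^p at the matrices B_j^(1/p). *)
Lemma arith_le_quasi_mean (B : 'I_n -> 'M[R[i]]_m) (p : R) :
  (forall j, posdefmx (B j)) -> 0 < p <= 1 -> forall x,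
  \sum_j (w j)%:C * qform (B j) x <= qform (quasi_mean (1 / p) w B) x.
Proof.
move=> pB /andP[p0 p1] x; have [w0 w1] := hw.
rewrite /quasi_mean.
have -> : 1 / (1 / p) = p by rewrite !div1r invrK.
have pC j : posdefmx (mxpow (B j) (1 / p)) by exact: mxpow_posdef.
have eB j : qform (B j) x = qform (mxpow (mxpow (B j) (1 / p)) p) x.
  by rewrite (mxpow_mxpow _ _ (pB j)) div1r mulVf ?gt_eqF// (mxpow1 (pB j)).
under eq_bigr => j _ do rewrite eB.
apply: (power_jensen pC) => [j||||y].
- exact: ltW.
- exact: (posdef_sum prob_vector_index w0 pC).
- by rewrite p1 ltW.
- by rewrite w1.
by rewrite (qform_sum w (fun j => mxpow (B j) (1 / p))).
Qed.

(** The bound of [renyi_mean_le] at a unit vector where the form of X takes the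
    value M only involves M and the spectra of the A_j, and can be solved for M. *)
Lemma renyi_mean_max_le (X : 'M[R[i]]_m) (t z M : R) v :
  is_renyi_mean t z w A X -> 0 < t -> t <= z -> z < 1 -> 0 < M ->
  (forall x, qform (mxpow X (t / z)) x <= (M `^ (t / z))%:C * qform 1%:M x) ->
  qform (1%:M : 'M[R[i]]_m) v = 1 -> qform X v = M%:C -> M <= lambdaM A.
Proof.
move=> hX t0 tz z1 M0 hM v1 vM; have [w0 w1] := hw.
have t1 : t < 1 by exact: le_lt_trans z1.
apply: (@le_of_le_powRM _ _ _ t) => //; first by exact: bigmax_ge_id.
  by rewrite t0.
have := renyi_mean_le hX t0 tz z1 M0 hM v; rewrite vM => /le_trans h.
rewrite -lecR rmorphM; apply: h; apply: ler_wpM2l.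
  by rewrite lecR powR_ge0.
apply: (@le_trans _ _ (\sum_j (w j)%:C * (lambdaM A `^ (1 - t))%:C)).
  apply: ler_sum => j _; apply: ler_wpM2l; first by rewrite lecR ltW.
  rewrite -[leRHS]mulr1 -v1; apply: mxpow_le_lambda1 => //.
    exact: lambdaM_ge.
  by rewrite subr_ge0 ltW.
by rewrite -mulr_suml -rmorph_sum w1 mul1r.
Qed.

End Renyi.

Unset Implicit Arguments.

Theorem corollary5p3 (R : realType) (m n : nat) (hm : (0 < m)%N)
    (A : 'I_n -> 'M[R[i]]_m) (hA : forall j, posdefmx (A j))
    (w : 'I_n -> R) (hw : prob_vector w)
    (t z : R) (ht : 0 < t) (htz : t <= z) (hz : z < 1)
    (p : R) (hp : 0 < p) (hpz : p <= z)
    (X : 'M[R[i]]_m) (hX : is_renyi_mean t z w A X) :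
  loewner_le X
    ((lambdaM A `^ t)%:C
       *: quasi_mean (1 / p) w (fun j => mxpow (A j) (1 - t))).
Proof.
have [w0 w1] := hw; have [pX _] := hX.
have pB j : posdefmx (mxpow (A j) (1 - t)) by exact: mxpow_posdef.
have p01 : 0 < p <= 1 by rewrite hp ltW// (le_lt_trans hpz).
have [M [M0 hM [v v1 vM]]] := posdef_max_eigen hm pX.
have tz0 : 0 <= t / z by rewrite divr_ge0// ltW// (lt_le_trans ht).
have ML : M <= lambdaM A.
  exact: (renyi_mean_max_le hA hw hX ht htz hz M0 (fun x => hM _ x tz0) v1 vM).
have pQ : posdefmx (quasi_mean (1 / p) w (fun j => mxpow (A j) (1 - t))).
  exact: quasi_mean_posdef.
have L0 : 0 < lambdaM A by exact: lt_le_trans ML.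
apply/loewner_leP; [exact: posdef_ct| |].
  by apply: posdef_ct; apply: posdefZ; rewrite ?powR_gt0.
move=> x; rewrite qformZ.
apply: (le_trans (renyi_mean_le hA hw hX ht htz hz M0 (fun x => hM _ x tz0) x)).
apply: ler_pM.
- by rewrite lecR powR_ge0.
- apply: sumr_ge0 => j _; apply: mulr_ge0; first by rewrite lecR ltW.
  exact: (posdef_qform_ge0 _ (pB j)).
- by rewrite lecR ge0_ler_powR// ?nnegrE ltW.
exact: arith_le_quasi_mean.
Qed.
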